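(* Let $(\hat{\mathcal{A}},[\cdot,\cdot]_\wedge,\hat N)$ be an abelian extension of a Nijenhuis mock-Lie algebra $(\mathcal{A},[\cdot,\cdot],N)$ by $(V,\mu,N_V)$ (where $\mu=0$). For a section $s:\mathcal{A}\to\hat{\mathcal{A}}$ define linear maps $\psi:\mathcal{A}\otimes\mathcal{A}\to V$ and $\chi:\mathcal{A}\to V$ by $$\psi(x\otimes y)=[s(x),s(y)]_\wedge-s([x,y]),\qquad\chi(x)=\hat N(s(x))-s(N(x)).$$ Then the cohomology class of $(\psi,\chi)$ does not depend on the choice of the section $s$.
   Context: All vector spaces are over a field $K$ of characteristic zero. A mock-Lie algebra $(\mathcal{A},[\cdot,\cdot])$ is a vector space with a commutative bilinear map $[\cdot,\cdot]$ such that $[x,[y,z]]+[y,[z,x]]+[z,[x,y]]=0$. A Nijenhuis mock-Lie algebra $(\mathcal{A},[\cdot,\cdot],N)$ is a mock-Lie algebra with a linear map $N$ such that $[N(x),N(y)]+N^2([x,y])=N([N(x),y])+N([x,N(y)])$. Morphisms are linear maps commuting with brackets and with the operators. Let $V$ be a vector space with a linear operator $N_V$ and zero bracket $\mu=0$; then $(V,\mu,N_V)$ is a Nijenhuis mock-Lie algebra. An abelian extension of $(\mathcal{A},[\cdot,\cdot],N)$ by $(V,\mu,N_V)$ is a Nijenhuis mock-Lie algebra $(\hat{\mathcal{A}},[\cdot,\cdot]_\wedge,\hat N)$ together with a short exact sequence of morphisms of Nijenhuis mock-Lie algebras $0\to V\xrightarrow{i}\hat{\mathcal{A}}\xrightarrow{p}\mathcal{A}\to0$;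 $V$ is identified with $i(V)$. A section is a linear map $s:\mathcal{A}\to\hat{\mathcal{A}}$ with $p\circ s=\mathrm{id}_{\mathcal{A}}$. The map $\bar\rho_V(x)(u)=[s(x),u]_\wedge$ ($x\in\mathcal{A},u\in V$) does not depend on $s$, and $(V,\bar\rho_V,N_V)$ is a representation of $(\mathcal{A},[\cdot,\cdot],N)$. Two pairs $(\psi_1,\chi_1)$, $(\psi_2,\chi_2)$ of linear maps $\psi_k:\mathcal{A}\otimes\mathcal{A}\to V$, $\chi_k:\mathcal{A}\to V$ are in the same cohomology class (with coefficients in $V$) if there is a linear map $\gamma:\mathcal{A}\to V$ such that for all $x,y\in\mathcal{A}$ $$\psi_1(x\otimes y)-\psi_2(x\otimes y)=\bar\rho_V(y)\gamma(x)+\bar\rho_V(x)\gamma(y)-\gamma([x,y]),\qquad\chi_1(x)-\chi_2(x)=N_V(\gamma(x))-\gamma(N(x)).$$ *)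

(* Defs.v *)
From HB Require Import structures.
From mathcomp Require Import all_boot all_order all_algebra.

Set Implicit Arguments.
Unset Strict Implicit.
Unset Printing Implicit Defensive.

Import GRing.Theory.
Local Open Scope ring_scope.

Record mockLie (K : fieldType) := MockLie {
  ml_car :> lmodType K;
  br : {bilinear ml_car -> ml_car -> ml_car};
  brC : forall x y, br x y = br y x;
  br_jacobi : forall x y z,
    br x (br y z) + br y (br z x) + br z (br x y) = 0
}.
Arguments br {K m}.

Record nijMockLie (K : fieldType) := NijMockLie {
  nml_ml :> mockLie K;
  nij : {linear nml_ml -> nml_ml};
  nij_br : forall x y,
    br (nij x) (nij y) + nij (nij (br x y))
      = nij (br (nij x) y) + nij (br x (nij y))
}.
Arguments nij {K n}.

Record nmlMor (K : fieldType) (A B : nijMockLie K) := NmlMor {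
  mor :> {linear A -> B};
  mor_br : forall x y, mor (br x y) = br (mor x) (mor y);
  mor_nij : forall x, mor (nij x) = nij (mor x)
}.

Section ZeroBracket.
Variables (K : fieldType) (V : lmodType K) (NV : {linear V -> V}).

Definition zero_br (_ _ : V) : V := 0.

Fact zero_br_bilinear : bilinear_for *:%R *:%R zero_br.
Proof. by split=> u a x y; rewrite /zero_br/= scaler0 addr0. Qed.

HB.instance Definition _ :=
  bilinear_isBilinear.Build K V V V *:%R *:%R zero_br zero_br_bilinear.

Fact zero_brC x y : zero_br x y = zero_br y x.
Proof. by []. Qed.

Fact zero_br_jacobi x y z :
  zero_br x (zero_br y z) + zero_br y (zero_br z x) + zero_br z (zero_br x y)
    = 0.
Proof. by rewrite /zero_br !addr0. Qed.

Fact zero_br_nij x y :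
  zero_br (NV x) (NV y) + NV (NV (zero_br x y))
    = NV (zero_br (NV x) y) + NV (zero_br x (NV y)).
Proof. by rewrite /zero_br !linear0. Qed.

Definition zero_ml : mockLie K :=
  @MockLie K V zero_br zero_brC zero_br_jacobi.

Definition zero_nml : nijMockLie K := @NijMockLie K zero_ml NV zero_br_nij.

End ZeroBracket.

Record abelianExt (K : fieldType) (A : nijMockLie K) (V : lmodType K)
    (NV : {linear V -> V}) := AbelianExt {
  hatA : nijMockLie K;
  ext_i : nmlMor (zero_nml NV) hatA;
  ext_p : nmlMor hatA A;
  ext_i_inj : injective ext_i;
  ext_exact : forall z : hatA, ext_p z = 0 <-> exists u : V, ext_i u = z;
  ext_p_surj : forall x : A, exists z : hatA, ext_p z = x
}.

Record section (K : fieldType) (A : nijMockLie K) (V : lmodType K)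
    (NV : {linear V -> V}) (E : abelianExt A NV) := Section_ {
  sec :> {linear A -> hatA E};
  secK : forall x, ext_p E (sec x) = x
}.

Section Cocycle.
Variables (K : fieldType) (A : nijMockLie K) (V : lmodType K).
Variables (NV : {linear V -> V}) (E : abelianExt A NV).

Let i : V -> hatA E := ext_i E.
Let p : {linear hatA E -> A} := ext_p E.

Let i_lin a u v : i (a *: u + v) = a *: i u + i v.
Proof. exact: (linearP (ext_i E)). Qed.

Let p_br (z t : hatA E) : p (br z t) = br (p z) (p t).
Proof. exact: mor_br. Qed.

Let p_i u : p (i u) = 0.
Proof. by apply/(ext_exact (a := E)); exists u. Qed.

Fact ker_p_im_i (z : hatA E) : p z = 0 -> exists u : V, i u == z.
Proof. by case/(ext_exact (a := E)) => u iu; exists u; apply/eqP. Qed.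

(* The inverse of [ext_i E] on its image, the kernel of [ext_p E]: this is
   the identification of V with i(V). *)
Definition unV (z : hatA E) (pz : p z = 0) : V := xchoose (ker_p_im_i pz).

Lemma unVK (z : hatA E) (pz : p z = 0) : ext_i E (unV pz) = z.
Proof. exact/eqP/(xchooseP (ker_p_im_i pz)). Qed.

Section FixedSection.
Variable s : section E.

Let ps x : p (s x) = x. Proof. exact: secK. Qed.

Fact rhobar_ker x u : p (br (s x) (i u)) = 0.
Proof. by rewrite p_br p_i linear0r. Qed.

Definition rhobar x u : V := unV (rhobar_ker x u).

Lemma rhobarE x u : ext_i E (rhobar x u) = br (s x) (ext_i E u).
Proof. exact: unVK. Qed.

Fact rhobar_bilinear : bilinear_for *:%R *:%R rhobar.
Proof.
split=> [u a x y|x a u v]; apply: (@ext_i_inj _ _ _ _ E).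
- apply/esym/(etrans (i_lin _ _ _)).
  by rewrite /i /= !rhobarE linearP linearPl.
- apply/esym/(etrans (i_lin _ _ _)).
  rewrite /i !rhobarE -linearPr.
  by apply: (congr1 (br (s x))); apply/esym/i_lin.
Qed.

HB.instance Definition _ :=
  bilinear_isBilinear.Build K A V V *:%R *:%R rhobar rhobar_bilinear.

Fact psi_ker x y : p (br (s x) (s y) - s (br x y)) = 0.
Proof. by rewrite linearB p_br !ps subrr. Qed.

Definition psi x y : V := unV (psi_ker x y).

Lemma psiE x y : ext_i E (psi x y) = br (s x) (s y) - s (br x y).
Proof. exact: unVK. Qed.

Fact psi_bilinear : bilinear_for *:%R *:%R psi.
Proof.
split=> [z a x y|z a x y]; apply: (@ext_i_inj _ _ _ _ E).
- apply/esym/(etrans (i_lin _ _ _)).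
  rewrite /i /= !psiE linearPl !linearP linearPl.
  by rewrite scalerBr addrACA /= scalerN.
- apply/esym/(etrans (i_lin _ _ _)).
  rewrite /i !psiE !linearP.
  by rewrite scalerBr addrACA /= scalerN.
Qed.

HB.instance Definition _ :=
  bilinear_isBilinear.Build K A A V *:%R *:%R psi psi_bilinear.

Fact chi_ker x : p (nij (s x) - s (nij x)) = 0.
Proof. by rewrite linearB /p mor_nij -/p !ps subrr. Qed.

Definition chi x : V := unV (chi_ker x).

Lemma chiE x : ext_i E (chi x) = nij (s x) - s (nij x).
Proof. exact: unVK. Qed.

Fact chi_linear : linear chi.
Proof.
move=> a x y; apply: (@ext_i_inj _ _ _ _ E).
apply/esym/(etrans (i_lin _ _ _)).
rewrite /i !chiE !linearP.
by rewrite scalerBr addrACA /= scalerN.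
Qed.

HB.instance Definition _ := GRing.isLinear.Build K A V *:%R chi chi_linear.

End FixedSection.

Lemma rhobar_indep (s t : section E) x u : rhobar s x u = rhobar t x u.
Proof.
apply: (@ext_i_inj _ _ _ _ E); rewrite !rhobarE; apply/eqP.
rewrite -subr_eq0 -linearBl.
have /ker_p_im_i[v /eqP <-] : p (s x - t x) = 0.
  by rewrite linearB /p !secK subrr.
by rewrite -(mor_br (ext_i E) v u) /= /zero_br linear0.
Qed.

End Cocycle.

(* Linear maps on a tensor product A (x) A are encoded as bilinear maps on A,
   as the library has no tensor product of arbitrary vector spaces. *)
Definition cochain (K : fieldType) (A : nijMockLie K) (V : lmodType K) : Type :=
  ({bilinear A -> A -> V} * {linear A -> V})%type.

Definition same_class (K : fieldType) (A : nijMockLie K) (V : lmodType K)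
    (NV : {linear V -> V}) (rho : {bilinear A -> V -> V})
    (c1 c2 : cochain A V) : Prop :=
  exists gamma : {linear A -> V},
    (forall x y : A, c1.1 x y - c2.1 x y
       = rho y (gamma x) + rho x (gamma y) - gamma (br x y)) /\
    (forall x : A, c1.2 x - c2.2 x = NV (gamma x) - gamma (nij x)).

Definition sec_cochain (K : fieldType) (A : nijMockLie K) (V : lmodType K)
    (NV : {linear V -> V}) (E : abelianExt A NV) (s : section E) :
    cochain A V :=
  (psi s : {bilinear A -> A -> V}, chi s : {linear A -> V}).

(* Main.v *)
Require Import Defs.
From HB Require Import structures.
From mathcomp Require Import all_boot all_order all_algebra.
Import GRing.Theory.
Local Open Scope ring_scope.

(** Two sections [s] and [t] agree modulo the kernel of the projection, so
their difference is [ext_i E] composed with a linear map [gamma : A -> V]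
([sec_diff] below), and [gamma] is the coboundary that relates the two
cocycles.  Indeed, the bracket being commutative,
   [br (s x) (s y) - br (t x) (t y)
     = br (s x) (s y - t y) + br (t y) (s x - t x)],
and the two terms on the right are the images of [rhobar s x (gamma y)] and
[rhobar t y (gamma x)]; as [rhobar] is the same for all sections
([rhobar_indep]), they are the two action terms of the coboundary.  The
remaining terms compare by linearity, and [ext_i E] commutes with the
operators, which gives the second equation.  Both equations are checked after
applying the injective map [ext_i E]. *)

Section SectionDifference.
Variables (K : fieldType) (A : nijMockLie K) (V : lmodType K).
Variables (NV : {linear V -> V}) (E : abelianExt A NV).

(** The domain of [ext_i E] is the carrier of [zero_nml NV], which is only
convertible to [V]; stating linearity on [V] lets it rewrite expressions
formed in [V]. *)
Lemma ext_iD (u v : V) : ext_i E (u + v) = ext_i E u + ext_i E v.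
Proof. exact: (linearD (ext_i E)). Qed.

Lemma ext_iB (u v : V) : ext_i E (u - v) = ext_i E u - ext_i E v.
Proof. exact: (linearB (ext_i E)). Qed.

Lemma ext_iP a (u v : V) : ext_i E (a *: u + v) = a *: ext_i E u + ext_i E v.
Proof. exact: (linearP (ext_i E)). Qed.

Lemma ext_i_nij (u : V) : ext_i E (NV u) = nij (ext_i E u).
Proof. exact: (mor_nij (ext_i E)). Qed.

Variables s t : section E.

Fact sec_diff_ker x : ext_p E (s x - t x) = 0.
Proof. by rewrite linearB !secK subrr. Qed.

Definition sec_diff x : V := unV (sec_diff_ker x).

Lemma sec_diffE x : ext_i E (sec_diff x) = s x - t x.
Proof. exact: unVK. Qed.

Fact sec_diff_linear : linear sec_diff.
Proof.
move=> a x y; apply: (@ext_i_inj _ _ _ _ E).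
by rewrite ext_iP !sec_diffE !linearP scalerBr addrACA /= scalerN.
Qed.

HB.instance Definition _ := GRing.isLinear.Build K A V *:%R sec_diff
  sec_diff_linear.

Lemma psi_sub (r : section E) x y :
  psi s x y - psi t x y
    = rhobar r y (sec_diff x) + rhobar r x (sec_diff y) - sec_diff (br x y).
Proof.
(* The action terms are read through different sections, [t] at y and [s] at
   x, so that the mixed brackets cancel. *)
rewrite (rhobar_indep r t y) (rhobar_indep r s x).
apply: (@ext_i_inj _ _ _ _ E).
rewrite !ext_iB ext_iD !psiE !rhobarE !sec_diffE !linearBr /=.
rewrite (brC (t y) (s x)) (brC (t y) (t x)).
by rewrite [X in _ = X - _]addrC subrKA !opprD !opprK addrACA.
Qed.

Lemma chi_sub x :
  chi s x - chi t x = NV (sec_diff x) - sec_diff (nij x).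
Proof.
apply: (@ext_i_inj _ _ _ _ E).
rewrite !ext_iB ext_i_nij !chiE !sec_diffE (linearB nij).
by rewrite !opprD !opprK addrACA.
Qed.

End SectionDifference.

Arguments sec_diff {K A V NV E} s t x.

Theorem proposition3p9 (K : fieldType) (charK0 : [pchar K] =i pred0)
    (A : nijMockLie K) (V : lmodType K) (NV : {linear V -> V})
    (E : abelianExt A NV) (s0 s1 s2 : section E) :
  same_class NV (rhobar s0) (sec_cochain s1) (sec_cochain s2).
Proof.
exists (sec_diff s1 s2 : {linear A -> V}).
by split=> [x y|x]; [exact: psi_sub | exact: chi_sub].
Qed.
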